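(* For every real $s>1+\sqrt{2}$, the matrix $$A_{252}(s):=\begin{pmatrix}s^4&s^5&-s^3\\ s^5&s^6&-s^4\\ s^3&s^4&s^2\end{pmatrix}$$ has $9$ distinct regular Pareto eigenvalues and admits an assigned support map with detailed profile $(1,1,0;1,2,2;2)$.
   Context: Vector inequalities are componentwise ($u>0$ means all components are positive). For $A\in\mathbb{R}^{n\times n}$, a real number $\lambda$ is a Pareto eigenvalue of $A$ if there is $x\in\mathbb{R}^n\setminus\{0\}$ with $x\ge 0$, $Ax-\lambda x\ge 0$ and $\langle x,Ax-\lambda x\rangle=0$. The set of Pareto eigenvalues is $\Pi(A)$. A support is a nonempty subset $J\subseteq\{1,\dots,n\}$, with complement $J^{\mathrm c}$; $A_J$ is the principal submatrix indexed by $J$ and $A_{J^{\mathrm c},J}$ is the submatrix with rows in $J^{\mathrm c}$ and columns in $J$. The support $J$ produces $\lambda\in\mathbb{R}$ if there is $u\in\mathbb{R}^{|J|}$ with $A_Ju=\lambda u$, $u>0$, $A_{J^{\mathrm c},J}u\ge 0$. The set of values produced by $J$ is $\Pi_J(A)$; one has $\Pi(A)=\bigcup_J\Pi_J(A)$. A value $\lambda\in\Pi_J(A)$ is regularly produced by $J$ if it is an algebraically simple eigenvalue of $A_J$ and every component of $A_{J^{\mathrm c},J}u$ is positive, where $u$ is the vector above (the second condition is empty if $J=\{1,\dots,n\}$). A Pareto eigenvalue is regular if it is regularly produced by at least one support. An assigned support map for $A$ is a map $\tau$ from $\Pi(A)$ to the set of supports such that $\lambda\in\Pi_{\tau(\lambda)}(A)$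 for every $\lambda\in\Pi(A)$. Put $m_J:=|\{\lambda\in\Pi(A):\tau(\lambda)=J\}|$. For $n=3$ the detailed (assigned) profile is $(m_1,m_2,m_3;m_{12},m_{13},m_{23};m_{123})$, where $m_i=m_{\{i\}}$, $m_{ij}=m_{\{i,j\}}$, $m_{123}=m_{\{1,2,3\}}$. *)

(* Defs.v *)
From HB Require Import structures.
From mathcomp Require Import all_boot all_order all_algebra.
From mathcomp Require Import all_classical all_reals.

Set Implicit Arguments.
Unset Strict Implicit.
Unset Printing Implicit Defensive.

Import Order.TTheory GRing.Theory Num.Theory.
Local Open Scope set_scope.
Local Open Scope ring_scope.

Section Pareto.
Context {R : realType} {n : nat}.
Implicit Types (A : 'M[R]_n) (J : {set 'I_n}) (lambda : R).

Definition vnonneg (m : nat) (u : 'cV[R]_m) : Prop := forall i, 0 <= u i 0.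
Definition vpos (m : nat) (u : 'cV[R]_m) : Prop := forall i, 0 < u i 0.
Definition dotv (m : nat) (u v : 'cV[R]_m) : R := \sum_i u i 0 * v i 0.

Definition pareto_eigenvalue A lambda : Prop :=
  exists x : 'cV[R]_n,
    [/\ x != 0, vnonneg x, vnonneg (A *m x - lambda *: x)
      & dotv x (A *m x - lambda *: x) = 0].

Definition pareto_spectrum A : set R :=
  [set lambda | pareto_eigenvalue A lambda]%classic.

Definition is_support J : Prop := J != finset.set0.

(* Rows and columns are listed in increasing order of the indices. *)
Definition principal_submx A J : 'M[R]_#|J| :=
  mxsub (@enum_val _ (mem J)) (@enum_val _ (mem J)) A.

Definition offdiag_submx A J : 'M[R]_(#|~: J|, #|J|) :=
  mxsub (@enum_val _ (mem (~: J))) (@enum_val _ (mem J)) A.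

Definition produced_with A J lambda (u : 'cV[R]_#|J|) : Prop :=
  [/\ principal_submx A J *m u = lambda *: u, vpos u
    & vnonneg (offdiag_submx A J *m u)].

Arguments produced_with : clear implicits.

Definition produced_set A J : set R :=
  [set lambda | is_support J /\ exists u, produced_with A J lambda u]%classic.

Definition algebraically_simple (m : nat) (B : 'M[R]_m) lambda : Prop :=
  mup lambda (char_poly B) = 1%N.

(* Simplicity of lambda makes u unique up to a positive factor, so that the
   choice of u is immaterial. *)
Definition regularly_produced A J lambda : Prop :=
  [/\ is_support J, algebraically_simple (principal_submx A J) lambda
    & exists2 u, produced_with A J lambda u & vpos (offdiag_submx A J *m u)].

Definition regular_pareto_eigenvalue A lambda : Prop :=
  pareto_eigenvalue A lambda /\ exists J, regularly_produced A J lambda.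

(* A map on the Pareto spectrum is represented by a function on R, of which
   only the values on the spectrum matter, here and in the counts below. *)
Definition assigned_support_map A (tau : R -> {set 'I_n}) : Prop :=
  forall lambda, pareto_spectrum A lambda -> produced_set A (tau lambda) lambda.

(* Stated as a relation, so that an infinite fibre has no count. *)
Definition support_count A (tau : R -> {set 'I_n}) J (k : nat) : Prop :=
  ([set lambda | pareto_spectrum A lambda /\ tau lambda = J]%classic #= `I_k)%card.

End Pareto.

(* The indices 1, 2, 3 are the ordinals 0, 1, 2 of 'I_3. *)
Definition idx1 : 'I_3 := @Ordinal 3 0 isT.
Definition idx2 : 'I_3 := @Ordinal 3 1 isT.
Definition idx3 : 'I_3 := @Ordinal 3 2 isT.

Definition detailed_profile (R : realType) (A : 'M[R]_3)
    (tau : R -> {set 'I_3}) (m1 m2 m3 m12 m13 m23 m123 : nat) : Prop :=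
  [/\ [/\ support_count A tau [set idx1] m1,
          support_count A tau [set idx2] m2
        & support_count A tau [set idx3] m3],
      [/\ support_count A tau [set idx1; idx2] m12,
          support_count A tau [set idx1; idx3] m13
        & support_count A tau [set idx2; idx3] m23]
    & support_count A tau [set: 'I_3] m123].

Definition A252 (R : realType) (s : R) : 'M[R]_3 :=
  \matrix_(i < 3, j < 3)
    (nth [::] [:: [:: s ^+ 4; s ^+ 5; - s ^+ 3];
                  [:: s ^+ 5; s ^+ 6; - s ^+ 4];
                  [:: s ^+ 3; s ^+ 4; s ^+ 2]] i)`_j.

(* Main.v *)
(* A Pareto eigenvector and its image are complementary, so its support decides
   everything, and rows 1 and 2 of the matrix are proportional. Write
   [lambda = s ^+ 2 * mu]. Supports avoiding the third index give
   [mu = s ^+ 2], [s ^+ 4] and [s ^+ 2 + s ^+ 4] (and nothing for [{3}]). Adjoining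
   the third index replaces such a value [t] by the two roots of
   [mu ^+ 2 - (t + 1) * mu + 2 * t], which are real and distinct exactly because
   [s > 1 + sqrt 2] makes [t ^+ 2 - 6 * t + 1] positive, and exceed [1], which
   makes the eigenvectors positive. Since [mu] determines
   [t = mu * (mu - 1) / (mu - 2)], roots for different [t] are different. *)
Require Import Defs.
From HB Require Import structures.
From mathcomp Require Import all_boot all_order all_algebra.
From mathcomp Require Import perm.
From mathcomp Require Import all_classical all_reals.
From mathcomp Require Import ring lra.

Set Implicit Arguments.
Unset Strict Implicit.
Unset Printing Implicit Defensive.

Import Order.TTheory GRing.Theory Num.Theory.
Local Open Scope set_scope.
Local Open Scope ring_scope.

(** * Cardinality of a set listed without repetition *)

Lemma card_set_uniq_seq (T : choiceType) (r : seq T) :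
  uniq r -> ([set` r] #= `I_(size r))%card.
Proof.
elim: r => [_|x r IH /= /andP[xr ur]] /=.
  by rewrite II0 set_nil card_eq00.
apply/eq_cardSP; exists x; first by rewrite /= mem_head.
have -> : ([set` x :: r] `\ x = [set` r])%classic; last exact: IH.
apply/seteqP; split=> y /=.
  by rewrite in_cons => -[/orP[/eqP ->|//]] /(_ erefl).
by move=> yr; rewrite in_cons yr orbT; split=> // yx; rewrite -yx yr in xr.
Qed.

(** * Support witnesses and support counts for a general matrix *)

Section Supports.
Context {R : realType} {n : nat}.
Implicit Types (A : 'M[R]_n) (J : {set 'I_n}) (lambda : R) (x : 'cV[R]_n).

(* The vector [u] of a regularly produced value, extended by zero outside [J]. *)
Definition strict_witness A J lambda x :=
  J != finset.set0 /\
  forall i, if i \in J then 0 < x i 0 /\ (A *m x) i 0 = lambda * x i 0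
            else x i 0 = 0 /\ 0 < (A *m x) i 0.

(** Deleted columns meet only zero entries of [x]. The row selection [h] is arbitrary, so that the
    principal and the off-diagonal blocks are both covered. *)
Lemma mulmx_rowsub_enum_val m (h : 'I_m -> 'I_n) A J x :
  (forall i, i \notin J -> x i 0 = 0) ->
  mxsub h (@enum_val _ (mem J)) A *m rowsub (@enum_val _ (mem J)) x
  = rowsub h (A *m x).
Proof.
move=> x0; apply/matrixP => i j; rewrite !mxE ord1.
rewrite (bigID (mem J)) /= [X in _ = _ + X]big1 ?addr0; last first.
  by move=> k kJ; rewrite x0 // mulr0.
by rewrite [RHS]big_enum_val; apply: eq_bigr => k _; rewrite !mxE.
Qed.

Lemma strict_witness_produced A J lambda x :
  strict_witness A J lambda x ->
  exists2 u, @produced_with R n A J lambda u & vpos (offdiag_submx A J *m u).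
Proof.
move=> [_ w].
have x0 i : i \notin J -> x i 0 = 0 by move: (w i); case: ifP => // _ [].
have off : vpos (offdiag_submx A J *m rowsub (@enum_val _ (mem J)) x).
  rewrite /offdiag_submx mulmx_rowsub_enum_val // => i; rewrite !mxE.
  have := w (enum_val i); have := enum_valP i; rewrite inE => /negbTE -> [_].
  by rewrite mxE.
exists (rowsub (@enum_val _ (mem J)) x) => //; split.
- rewrite /principal_submx mulmx_rowsub_enum_val //; apply/matrixP => i j.
  rewrite ord1 mxE; have := w (enum_val i); rewrite enum_valP => -[_ ->].
  by rewrite !mxE.
- by move=> i; rewrite mxE; have := w (enum_val i); rewrite enum_valP => -[].
- by move=> i; exact/ltW/off.
Qed.

Lemma strict_witness_pareto A J lambda x :
  strict_witness A J lambda x -> pareto_eigenvalue A lambda.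
Proof.
move=> [/set0Pn[i0 i0J] w]; exists x; split.
- apply: contraTneq i0J => x0; apply/negP => i0J.
  by have := w i0; rewrite i0J x0 mxE ltxx => -[].
- by move=> i; have := w i; case: ifP => _ [] => [/ltW|->].
- move=> i; rewrite mxE [X in _ + X]mxE [X in _ - X]mxE.
  have := w i; case: ifP => _ [] => [_ ->|->]; first by rewrite subrr.
  by rewrite mulr0 subr0 => /ltW.
- rewrite /dotv big1 // => i _; rewrite mxE [X in _ + X]mxE [X in _ - X]mxE.
  have := w i; case: ifP => _ [] => [_ ->|-> _]; last by rewrite mul0r.
  by rewrite subrr mulr0.
Qed.

(** Two enumerations of one index set differ by a permutation, which acts on rows and columns alike,
    so its sign enters squared. This replaces [enum_val] by an explicit tuple. *)
Lemma char_poly_mxsub_codom k m (f : 'I_k -> 'I_n) (g : 'I_m -> 'I_n) A :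
  injective f -> injective g -> codom f =i codom g ->
  char_poly (mxsub f f A) = char_poly (mxsub g g A).
Proof.
move=> fI gI fg; have km : k = m.
  by rewrite -(card_ord k) -(card_ord m) -(card_codom fI) -(card_codom gI) (eq_card fg).
subst m.
have gf i : f i \in codom g by rewrite -fg codom_f.
pose h i := iinv (gf i).
have gh i : g (h i) = f i by rewrite f_iinv.
have hI : injective h by move=> i j hij; apply: fI; rewrite -!gh hij.
rewrite /char_poly.
have -> : char_poly_mx (mxsub f f A) =
    row_perm (perm hI) (col_perm (perm hI) (char_poly_mx (mxsub g g A))).
  apply/matrixP => i j; rewrite !mxE !permE /= !gh.
  by rewrite (inj_eq hI).
rewrite row_permE col_permE !det_mulmx !det_perm odd_permV.
by rewrite mulrCA -expr2 sqrr_sign mulr1.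
Qed.

(** Simplicity is read off a split characteristic polynomial: a member of a duplicate-free list of
    roots has multiplicity one. *)
Lemma regularly_produced_tuple k (t : k.-tuple 'I_n) A lambda x (r : seq R) :
  uniq t -> strict_witness A [set i in t] lambda x ->
  char_poly (mxsub (tnth t) (tnth t) A) = \prod_(y <- r) ('X - y%:P) ->
  uniq r -> lambda \in r ->
  pareto_eigenvalue A lambda /\ regularly_produced A [set i in t] lambda.
Proof.
move=> ut w cp ur lr; split; first exact: strict_witness_pareto w.
split; [exact: w.1| |exact: strict_witness_produced w].
rewrite /algebraically_simple /principal_submx.
rewrite (char_poly_mxsub_codom (g := tnth t)).
- by rewrite cp mu_prod_XsubC count_uniq_mem ?lr.
- exact: enum_val_inj.
- exact/tuple_uniqP.
move=> i; apply/codomP/codomP => -[j ->].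
  by have := enum_valP j; rewrite inE => /tnthP.
have jJ : tnth t j \in [set i in t] by rewrite inE mem_tnth.
by exists (enum_rank_in jJ (tnth t j)); rewrite enum_rankK_in.
Qed.

(** The map sends the i-th value to the i-th support, so its fibre over [J] is a sublist of [vals]
    as long as the number of occurrences of [J] in [supps]. *)
Lemma support_count_index A (vals : seq R) (supps : seq {set 'I_n}) J :
  uniq vals -> size supps = size vals -> pareto_spectrum A = [set` vals]%classic ->
  support_count A (fun y => nth finset.set0 supps (index y vals)) J
    (count_mem J supps).
Proof.
move=> uv sz spec; set tau := fun y => _.
have ms : map tau vals = supps.
  apply: (@eq_from_nth _ finset.set0); rewrite size_map // => i ilt.
  by rewrite (nth_map 0) // /tau index_uniq.
rewrite -ms count_map /support_count.
have -> : [set y | pareto_spectrum A y /\ tau y = J]%classic =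
    [set` seq.filter (preim tau (pred1 J)) vals]%classic.
  rewrite spec; apply/seteqP; split=> y /=; rewrite mem_filter /=.
    by move=> [-> ->]; rewrite eqxx.
  by move=> /andP[/eqP -> ->].
by rewrite -size_filter; apply: card_set_uniq_seq; rewrite filter_uniq.
Qed.

End Supports.

(** * Characteristic polynomials in dimensions 1, 2 and 3 *)

Lemma char_poly1 (R : comNzRingType) (B : 'M[R]_1) :
  char_poly B = \prod_(y <- [:: B 0 0]) ('X - y%:P).
Proof. by rewrite big_seq1 /char_poly det_mx11 !mxE. Qed.

Lemma det_mx22 (R : comNzRingType) (B : 'M[R]_2) :
  \det B = B 0 0 * B 1 1 - B 0 1 * B 1 0.
Proof.
(* Indexing by natural numbers identifies the differently written ordinals that the expansion
   creates. *)
pose f i j := B (inord i) (inord j).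
have fE i j : B i j = f i j by rewrite /f !inord_val.
rewrite (expand_det_row _ 0) !big_ord_recl big_ord0 /cofactor !det_mx11 !mxE.
by rewrite !fE /=; ring.
Qed.

Lemma det_mx33 (R : comNzRingType) (B : 'M[R]_3) :
  \det B = B 0 0 * (B 1 1 * B 2 2 - B 1 2 * B 2 1)
          - B 0 1 * (B 1 0 * B 2 2 - B 1 2 * B 2 0)
          + B 0 2 * (B 1 0 * B 2 1 - B 1 1 * B 2 0).
Proof.
pose f i j := B (inord i) (inord j).
have fE i j : B i j = f i j by rewrite /f !inord_val.
rewrite (expand_det_row _ 0) !big_ord_recl big_ord0 /cofactor !det_mx22 !mxE.
by rewrite !fE /=; ring.
Qed.

(** Vieta's relations: the roots need only match trace and determinant, so they never have to be
    written explicitly. *)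
Lemma char_poly2 (R : comNzRingType) (B : 'M[R]_2) r1 r2 :
  r1 + r2 = B 0 0 + B 1 1 -> r1 * r2 = B 0 0 * B 1 1 - B 0 1 * B 1 0 ->
  char_poly B = \prod_(y <- [:: r1; r2]) ('X - y%:P).
Proof.
move=> tr dt; rewrite !big_cons big_nil mulr1.
have -> : ('X - r1%:P) * ('X - r2%:P) = 'X * 'X - (r1 + r2)%:P * 'X + (r1 * r2)%:P.
  by rewrite polyCD polyCM; ring.
rewrite tr dt /char_poly det_mx22 !mxE /=.
by rewrite !polyCB !polyCM !polyCD; ring.
Qed.

Lemma char_poly3 (R : comNzRingType) (B : 'M[R]_3) r1 r2 r3 :
  r1 + r2 + r3 = B 0 0 + B 1 1 + B 2 2 ->
  r1 * r2 + r1 * r3 + r2 * r3 =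
    (B 0 0 * B 1 1 - B 0 1 * B 1 0) + (B 0 0 * B 2 2 - B 0 2 * B 2 0)
    + (B 1 1 * B 2 2 - B 1 2 * B 2 1) ->
  r1 * r2 * r3 = B 0 0 * (B 1 1 * B 2 2 - B 1 2 * B 2 1)
          - B 0 1 * (B 1 0 * B 2 2 - B 1 2 * B 2 0)
          + B 0 2 * (B 1 0 * B 2 1 - B 1 1 * B 2 0) ->
  char_poly B = \prod_(y <- [:: r1; r2; r3]) ('X - y%:P).
Proof.
move=> e1 e2 e3; rewrite !big_cons big_nil mulr1.
have -> : ('X - r1%:P) * (('X - r2%:P) * ('X - r3%:P)) =
    'X * 'X * 'X - (r1 + r2 + r3)%:P * 'X * 'X
    + (r1 * r2 + r1 * r3 + r2 * r3)%:P * 'X - (r1 * r2 * r3)%:P.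
  by rewrite !polyCD !polyCM; ring.
rewrite e1 e2 e3 /char_poly det_mx33 !mxE /=.
by rewrite !(polyCB, polyCM, polyCD); ring.
Qed.

(** * The reduced quadratic *)

(* The eigenvalue problem on a support containing the third index reduces to
   [mu ^+ 2 - (t + 1) * mu + 2 * t = 0], of discriminant [t ^+ 2 - 6 * t + 1]. *)
Lemma reduced_roots (R : rcfType) (t : R) :
  2 < t -> 0 < t ^+ 2 - 6 * t + 1 ->
  exists m1 m2 : R,
    [/\ m1 + m2 = t + 1, m1 * m2 = 2 * t, 1 < m1, 1 < m2 & m1 != m2].
Proof.
move=> t2 disc; set d := Num.sqrt (t ^+ 2 - 6 * t + 1).
have d2 : d * d = t ^+ 2 - 6 * t + 1 by rewrite -expr2 sqr_sqrtr // ltW.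
have d0 : 0 < d by rewrite sqrtr_gt0.
(* Here [(t - 1) ^+ 2 - d ^+ 2 = 4 * t]; the bound is what puts the smaller root above 1. *)
have dt : d < t - 1.
  by rewrite -(ltr_pXn2r (_ : (0 < 2)%N)) ?nnegrE //; [rewrite expr2 d2; nra|lra|lra].
exists ((t + 1 - d) / 2), ((t + 1 + d) / 2); split.
- by field.
- have -> : (t + 1 - d) / 2 * ((t + 1 + d) / 2) = ((t + 1) ^+ 2 - d * d) / 4 by field.
  by rewrite d2; field.
- by lra.
- by lra.
- by rewrite lt_eqF //; lra.
Qed.

Definition reduced_poly (R : comNzRingType) (t m : R) := m ^+ 2 - (t + 1) * m + 2 * t.

Lemma reduced_poly_root (R : comNzRingType) (t m1 m2 : R) :
  m1 + m2 = t + 1 -> m1 * m2 = 2 * t ->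
  reduced_poly t m1 = 0 /\ reduced_poly t m2 = 0.
Proof. by move=> e1 e2; rewrite /reduced_poly -e1 -e2; split; ring. Qed.

Lemma reduced_poly_root_inj (R : realFieldType) (t t' m : R) :
  reduced_poly t m = 0 -> reduced_poly t' m = 0 -> t = t'.
Proof.
rewrite /reduced_poly => h h'.
(* At [m = 2] the polynomial is 2 whatever [t] is; for other [m] it is affine in [t] with nonzero
   slope [2 - m]. *)
have [m2|m2] := eqVneq m 2; first by move: h; rewrite m2; lra.
apply/eqP; rewrite -subr_eq0 -(mulIr_eq0 _ (mulIf (_ : m - 2 != 0))) ?subr_eq0 //.
by apply/eqP; lra.
Qed.

(** * Values produced by the supports of the matrix *)

Section A252.
Context {R : realType}.
Implicit Types (s lambda : R) (x : 'cV[R]_3).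

Lemma ord3P (P : 'I_3 -> Prop) : P idx1 -> P idx2 -> P idx3 -> forall i, P i.
Proof.
move=> P1 P2 P3 [[|[|[|//]]] ilt].
- by have -> : Ordinal ilt = idx1 by exact: val_inj.
- by have -> : Ordinal ilt = idx2 by exact: val_inj.
- by have -> : Ordinal ilt = idx3 by exact: val_inj.
Qed.

Lemma A252_mulmx s x :
  [/\ (A252 s *m x) idx1 0 = s ^+ 4 * x idx1 0 + s ^+ 5 * x idx2 0 - s ^+ 3 * x idx3 0,
      (A252 s *m x) idx2 0 = s ^+ 5 * x idx1 0 + s ^+ 6 * x idx2 0 - s ^+ 4 * x idx3 0
    & (A252 s *m x) idx3 0 = s ^+ 3 * x idx1 0 + s ^+ 4 * x idx2 0 + s ^+ 2 * x idx3 0].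
Proof.
have sumE (F : 'I_3 -> R) : \sum_i F i = F idx1 + F idx2 + F idx3.
  rewrite !big_ord_recl big_ord0 addr0 addrA.
  by congr (F _ + F _ + F _); apply: val_inj.
by split; rewrite !mxE sumE !mxE /= ?mulNr.
Qed.

Definition col3 (a b c : R) : 'cV[R]_3 := \col_i [:: a; b; c]`_i.

Lemma col3E a b c :
  (col3 a b c idx1 0 = a) * (col3 a b c idx2 0 = b) * (col3 a b c idx3 0 = c).
Proof. by rewrite !mxE. Qed.

Lemma A252_support1 s : 0 < s ->
  pareto_eigenvalue (A252 s) (s ^+ 2 * s ^+ 2) /\
  regularly_produced (A252 s) [set idx1] (s ^+ 2 * s ^+ 2).
Proof.
move=> s0; have -> : [set idx1] = [set i in [tuple idx1]] :> {set 'I_3}.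
  by apply/setP => i; rewrite !inE.
have [e1 e2 e3] := A252_mulmx s (col3 1 0 0); rewrite !col3E in e1 e2 e3.
apply: (@regularly_produced_tuple _ _ _ _ _ _ (col3 1 0 0) [:: s ^+ 2 * s ^+ 2]) => //.
- split; first by apply/set0Pn; exists idx1; rewrite inE.
  apply: ord3P; rewrite !inE /= !col3E ?e1 ?e2 ?e3; split=> //; first by ring.
  + by have := exprn_gt0 5 s0; lra.
  + by have := exprn_gt0 3 s0; lra.
- rewrite char_poly1 !mxE /=; congr (\prod_(y <- [:: _]) _); ring.
- by rewrite mem_seq1.
Qed.

Lemma A252_support2 s : 0 < s ->
  pareto_eigenvalue (A252 s) (s ^+ 2 * s ^+ 4) /\
  regularly_produced (A252 s) [set idx2] (s ^+ 2 * s ^+ 4).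
Proof.
move=> s0; have -> : [set idx2] = [set i in [tuple idx2]] :> {set 'I_3}.
  by apply/setP => i; rewrite !inE.
have [e1 e2 e3] := A252_mulmx s (col3 0 1 0); rewrite !col3E in e1 e2 e3.
apply: (@regularly_produced_tuple _ _ _ _ _ _ (col3 0 1 0) [:: s ^+ 2 * s ^+ 4]) => //.
- split; first by apply/set0Pn; exists idx2; rewrite inE.
  apply: ord3P; rewrite !inE /= !col3E ?e1 ?e2 ?e3; split=> //; last 2 first.
  + by ring.
  + by have := exprn_gt0 4 s0; lra.
  + by have := exprn_gt0 5 s0; lra.
- rewrite char_poly1 !mxE /=; congr (\prod_(y <- [:: _]) _); ring.
- by rewrite mem_seq1.
Qed.

(** The block is [s ^+ 4] times the outer square of [(1, s)], hence of rank one: [(1, s)] is an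
    eigenvector and the other eigenvalue is 0. *)
Lemma A252_support12 s : 0 < s ->
  pareto_eigenvalue (A252 s) (s ^+ 2 * (s ^+ 2 + s ^+ 4)) /\
  regularly_produced (A252 s) [set idx1; idx2] (s ^+ 2 * (s ^+ 2 + s ^+ 4)).
Proof.
move=> s0.
have -> : [set idx1; idx2] = [set i in [tuple idx1; idx2]] :> {set 'I_3}.
  by apply/setP => i; rewrite !inE.
have [e1 e2 e3] := A252_mulmx s (col3 1 s 0); rewrite !col3E in e1 e2 e3.
apply: (@regularly_produced_tuple _ _ _ _ _ _ (col3 1 s 0)
  [:: s ^+ 2 * (s ^+ 2 + s ^+ 4); 0]) => //.
- split; first by apply/set0Pn; exists idx1; rewrite inE.
  apply: ord3P; rewrite !inE /= !col3E ?e1 ?e2 ?e3; split=> //; try by ring.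
  by have := exprn_gt0 3 s0; have := exprn_gt0 5 s0; rewrite -exprSr; lra.
- by apply: char_poly2; rewrite !mxE /=; ring.
- rewrite /= inE andbT mulf_neq0 ?expf_neq0 ?gt_eqF // addr_gt0 // exprn_gt0 //.
- by rewrite mem_head.
Qed.

(** * Supports containing the third index, with [m1] and [m2] the roots belonging to [t] *)

Section Roots.
Variables (t m1 m2 : R).
Hypotheses (sum_m : m1 + m2 = t + 1) (prod_m : m1 * m2 = 2 * t).
Hypotheses (m1_gt1 : 1 < m1) (m2_gt1 : 1 < m2) (m1_neq_m2 : m1 != m2).

Lemma A252_support13 s m : 0 < s -> t = s ^+ 2 -> m \in [:: m1; m2] ->
  pareto_eigenvalue (A252 s) (s ^+ 2 * m) /\
  regularly_produced (A252 s) [set idx1; idx3] (s ^+ 2 * m).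
Proof.
move=> s0 ts mm.
have -> : [set idx1; idx3] = [set i in [tuple idx1; idx3]] :> {set 'I_3}.
  by apply/setP => i; rewrite !inE.
have m_gt1 : 1 < m by move: mm; rewrite !inE => /orP[] /eqP ->.
have root_m : m ^+ 2 - m = s ^+ 2 * (m - 2).
  have [r1 r2] := reduced_poly_root sum_m prod_m.
  by move: mm; rewrite !inE -ts => /orP[] /eqP ->; move: r1 r2; rewrite /reduced_poly; lra.
(* The third row reads [s * x1 = (m - 1) * x3], which dictates the vector; the first row is then the
   root equation. *)
have [e1 e2 e3] := A252_mulmx s (col3 (m - 1) 0 s); rewrite !col3E in e1 e2 e3.
have a0 : s ^+ 2 != 0 by rewrite expf_neq0 ?gt_eqF.
apply: (@regularly_produced_tuple _ _ _ _ _ _ (col3 (m - 1) 0 s)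
  [:: s ^+ 2 * m1; s ^+ 2 * m2]) => //.
- split; first by apply/set0Pn; exists idx1; rewrite inE.
  apply: ord3P; rewrite !inE /= !col3E ?e1 ?e2 ?e3; split=> //; try by ring.
  + by lra.
  + transitivity (s ^+ 2 * (s ^+ 2 * (m - 2))); first by ring.
    by rewrite -root_m; ring.
  (* The sign of [m - 2] comes from the root equation, as [m ^+ 2 - m] is positive for [m > 1]. *)
  + have -> : s ^+ 5 * (m - 1) + s ^+ 6 * 0 - s ^+ 4 * s =
      s ^+ 3 * (s ^+ 2 * (m - 2)) by ring.
    by rewrite -root_m mulr_gt0 ?exprn_gt0 //; nra.
- apply: char_poly2; rewrite !mxE /=.
  + by rewrite -mulrDr sum_m ts; ring.
  + by rewrite mulrACA prod_m ts; ring.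
- by rewrite /= inE andbT (inj_eq (mulfI a0)).
- by rewrite !inE !(inj_eq (mulfI a0)) in mm *.
Qed.

Lemma A252_support23 s m : 0 < s -> t = s ^+ 4 -> m \in [:: m1; m2] ->
  pareto_eigenvalue (A252 s) (s ^+ 2 * m) /\
  regularly_produced (A252 s) [set idx2; idx3] (s ^+ 2 * m).
Proof.
move=> s0 ts mm.
have -> : [set idx2; idx3] = [set i in [tuple idx2; idx3]] :> {set 'I_3}.
  by apply/setP => i; rewrite !inE.
have m_gt1 : 1 < m by move: mm; rewrite !inE => /orP[] /eqP ->.
have root_m : m ^+ 2 - m = s ^+ 4 * (m - 2).
  have [r1 r2] := reduced_poly_root sum_m prod_m.
  by move: mm; rewrite !inE -ts => /orP[] /eqP ->; move: r1 r2; rewrite /reduced_poly; lra.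
(* Now the third row reads [s ^+ 2 * x2 = (m - 1) * x3]. *)
have [e1 e2 e3] := A252_mulmx s (col3 0 (m - 1) (s ^+ 2)); rewrite !col3E in e1 e2 e3.
have a0 : s ^+ 2 != 0 by rewrite expf_neq0 ?gt_eqF.
apply: (@regularly_produced_tuple _ _ _ _ _ _ (col3 0 (m - 1) (s ^+ 2))
  [:: s ^+ 2 * m1; s ^+ 2 * m2]) => //.
- split; first by apply/set0Pn; exists idx2; rewrite inE.
  apply: ord3P; rewrite !inE /= !col3E ?e1 ?e2 ?e3; split=> //; try by ring.
  + have -> : s ^+ 4 * 0 + s ^+ 5 * (m - 1) - s ^+ 3 * s ^+ 2 =
      s * (s ^+ 4 * (m - 2)) by ring.
    by rewrite -root_m mulr_gt0 ?exprn_gt0 //; nra.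
  + by lra.
  + transitivity (s ^+ 2 * (s ^+ 4 * (m - 2))); first by ring.
    by rewrite -root_m; ring.
  + by rewrite exprn_gt0.
- apply: char_poly2; rewrite !mxE /=.
  + by rewrite -mulrDr sum_m ts; ring.
  + by rewrite mulrACA prod_m ts; ring.
- by rewrite /= inE andbT (inj_eq (mulfI a0)).
- by rewrite !inE !(inj_eq (mulfI a0)) in mm *.
Qed.

Lemma A252_support123 s m : 0 < s -> t = s ^+ 2 + s ^+ 4 -> m \in [:: m1; m2] ->
  pareto_eigenvalue (A252 s) (s ^+ 2 * m) /\
  regularly_produced (A252 s) [set: 'I_3] (s ^+ 2 * m).
Proof.
move=> s0 ts mm.
have -> : [set: 'I_3] = [set i in [tuple idx1; idx2; idx3]].
  by apply/setP; apply: ord3P; rewrite !inE.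
have m_gt1 : 1 < m by move: mm; rewrite !inE => /orP[] /eqP ->.
have root_m : m ^+ 2 - m = (s ^+ 2 + s ^+ 4) * (m - 2).
  have [r1 r2] := reduced_poly_root sum_m prod_m.
  by move: mm; rewrite !inE -ts => /orP[] /eqP ->; move: r1 r2; rewrite /reduced_poly; lra.
(* Proportionality of the first two rows forces [x2 = s * x1]; the third row then gives
   [(s + s ^+ 3) * x1 = (m - 1) * x3]. *)
pose w := col3 (m - 1) (s * (m - 1)) (s + s ^+ 3).
have [e1 e2 e3] := A252_mulmx s w; rewrite !col3E in e1 e2 e3.
have a0 : s ^+ 2 != 0 by rewrite expf_neq0 ?gt_eqF.
(* The same proportionality makes 0 the third eigenvalue, and simplicity requires the other two to
   differ from it. *)
have m1_neq0 : m1 != 0 by rewrite gt_eqF // (lt_trans ltr01).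
have m2_neq0 : m2 != 0 by rewrite gt_eqF // (lt_trans ltr01).
apply: (@regularly_produced_tuple _ _ _ _ _ _ w
  [:: 0; s ^+ 2 * m1; s ^+ 2 * m2]) => //.
- split; first by apply/set0Pn; exists idx1; rewrite inE.
  apply: ord3P; rewrite !inE /= !col3E ?e1 ?e2 ?e3; split=> //; try by ring.
  + by lra.
  + transitivity (s ^+ 2 * ((s ^+ 2 + s ^+ 4) * (m - 2))); first by ring.
    by rewrite -root_m; ring.
  + by rewrite mulr_gt0 //; lra.
  + transitivity (s ^+ 3 * ((s ^+ 2 + s ^+ 4) * (m - 2))); first by ring.
    by rewrite -root_m; ring.
  + by rewrite addr_gt0 ?exprn_gt0.
- apply: char_poly3; rewrite !mxE /=.
  + by rewrite add0r -mulrDr sum_m ts; ring.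
  + by rewrite !mul0r !add0r mulrACA prod_m ts; ring.
  + by ring.
- rewrite /= !inE !andbT (inj_eq (mulfI a0)) m1_neq_m2 andbT.
  by rewrite negb_or !(eq_sym 0); apply/andP; split; exact: mulf_neq0.
- by rewrite !inE !(inj_eq (mulfI a0)) in mm *; rewrite mm orbT.
Qed.

(* The system left on a support containing the third index, once the first two
   coordinates are expressed through a single one, [y]. *)
Lemma reduced_system s lambda k l (x y : R) :
  0 < s -> k * l = s ^+ 4 * t -> x != 0 ->
  s ^+ 2 * t * y - k * x = lambda * y -> l * y + s ^+ 2 * x = lambda * x ->
  exists2 m, m \in [:: m1; m2] & lambda = s ^+ 2 * m.
Proof.
move=> s0 kl x0 h1 h2; have a0 : s ^+ 2 != 0 by rewrite expf_neq0 ?gt_eqF.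
pose m := lambda / s ^+ 2.
have lm : lambda = s ^+ 2 * m by rewrite /m mulrC divfK.
exists m => //; rewrite !inE -[m == m1]subr_eq0 -[m == m2]subr_eq0 -mulf_eq0.
have : s ^+ 4 * ((m - m1) * (m - m2)) * x = 0.
  have -> : (m - m1) * (m - m2) = m ^+ 2 - (t + 1) * m + 2 * t.
    by rewrite -sum_m -prod_m; ring.
  (* Multiplying the second equation by [lambda - s ^+ 2 * t] eliminates [y]. With
     [lambda = s ^+ 2 * m] the result is [(m - t) * (m - 1) = - t], up to the factor
     [s ^+ 4 * x]. *)
  have : (lambda - s ^+ 2 * t) * (lambda - s ^+ 2) * x = - (s ^+ 4 * t) * x.
    have e2 : (lambda - s ^+ 2) * x = l * y by rewrite mulrBl -h2; ring.
    have e1 : (lambda - s ^+ 2 * t) * y = - k * x by rewrite mulrBl -h1; ring.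
    by rewrite -mulrA e2 mulrCA e1 -kl; ring.
  by rewrite lm => /eqP; rewrite -subr_eq0 => /eqP <-; ring.
have s4n0 : s ^+ 4 != 0 by rewrite expf_neq0 ?gt_eqF.
by move=> h; apply/eqP/(mulfI s4n0)/(mulIf x0); rewrite h mulr0 mul0r.
Qed.

End Roots.


(** * Completeness and distinctness of the nine values *)

(* The values [lambda / s ^+ 2], listed in the order of their supports
   1, 2, 12, 13, 13, 23, 23, 123, 123. *)
Lemma A252_spectrum s (p1 p2 q1 q2 r1 r2 : R) : 0 < s ->
  p1 + p2 = s ^+ 2 + 1 -> p1 * p2 = 2 * s ^+ 2 ->
  q1 + q2 = s ^+ 4 + 1 -> q1 * q2 = 2 * s ^+ 4 ->
  r1 + r2 = s ^+ 2 + s ^+ 4 + 1 -> r1 * r2 = 2 * (s ^+ 2 + s ^+ 4) ->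
  forall lambda, pareto_eigenvalue (A252 s) lambda ->
  lambda \in [seq s ^+ 2 * m | m <- [:: s ^+ 2; s ^+ 4; s ^+ 2 + s ^+ 4;
                                      p1; p2; q1; q2; r1; r2]].
Proof.
move=> s0 sp pp sq pq sr pr lambda [x [xn0 x_ge0 y_ge0 xy]].
(* Complementarity: a vanishing sum of nonnegative products has only zero terms. *)
have comp i : 0 < x i 0 -> (A252 s *m x) i 0 = lambda * x i 0.
  move=> xi; apply/eqP; rewrite -subr_eq0.
  have := xy; rewrite /dotv => /eqP; rewrite psumr_eq0; last first.
    by move=> j _; rewrite mulr_ge0.
  move=> /allP /(_ i); rewrite mem_index_enum => /(_ isT).
  by rewrite /= mulf_eq0 gt_eqF //= !mxE.
have y3 i : 0 <= (A252 s *m x) i 0 - lambda * x i 0.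
  by have := y_ge0 i; rewrite !mxE.
have [e1 e2 e3] := A252_mulmx s x.
have xE : ~ [/\ x idx1 0 = 0, x idx2 0 = 0 & x idx3 0 = 0].
  move=> [z1 z2 z3]; move/eqP: xn0; apply; apply/matrixP => i j.
  by rewrite ord1 [RHS]mxE; move: i; apply: ord3P.
move: (comp idx1) (comp idx2) (comp idx3) (y3 idx1).
rewrite e1 e2 e3 => {comp y3 e1 e2 e3 y_ge0 xy xn0}.
move: xE; have := x_ge0 idx1; have := x_ge0 idx2; have := x_ge0 idx3.
move: (x idx1 0) (x idx2 0) (x idx3 0) => x1 x2 x3.
have sn0 : s != 0 by rewrite gt_eqF.
have root (m : R) (r : seq R) : m \in r -> lambda = s ^+ 2 * m ->
  lambda \in [seq s ^+ 2 * m | m <- r] by move=> mr ->; exact: map_f.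
(* The eight cases are the sets of positive coordinates, in the order empty, 1, 2, 12, 3, 13, 23,
   123. *)
rewrite !le_eqVlt => /predU1P[<-|x3p] /predU1P[<-|x2p] /predU1P[<-|x1p] xE c1 c2 c3 y1.
- by case: xE.
- move/(_ x1p): c1 => c1; apply: (root (s ^+ 2)); first by rewrite !inE eqxx.
  by apply: (mulIf (lt0r_neq0 x1p)); rewrite -c1; ring.
- move/(_ x2p): c2 => c2; apply: (root (s ^+ 4)); first by rewrite !inE eqxx !orbT.
  by apply: (mulIf (lt0r_neq0 x2p)); rewrite -c2; ring.
- move/(_ x1p): c1 => c1; move/(_ x2p): c2 => c2.
  apply: (root (s ^+ 2 + s ^+ 4)); first by rewrite !inE eqxx !orbT.
  (* The second row is [s] times the first, so [x2 = s * x1] once [lambda] is nonzero. *)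
  have lx : lambda * (s * x1 - x2) = 0 by rewrite mulrBr mulrCA -c1 -c2; ring.
  have l0 : lambda != 0.
    apply: contra_eq_neq c1 => ->; rewrite mul0r mulr0 subr0 gt_eqF //.
    by rewrite addr_gt0 // mulr_gt0 // exprn_gt0.
  have x2E : x2 = s * x1.
    by apply/eqP; rewrite eq_sym -subr_eq0; move/eqP: lx; rewrite mulf_eq0 (negbTE l0).
  by apply: (mulIf (lt0r_neq0 x1p)); rewrite -c1 x2E; ring.
(* On support 3 the first row equals [- s ^+ 3 * x3], which is negative, contrary to [y1]. *)
- move: y1; have : 0 < s ^+ 3 * x3 by rewrite mulr_gt0 ?exprn_gt0.
  by lra.
- move/(_ x1p): c1 => c1; move/(_ x3p): c3 => c3.
  have [|||m mp lm] := @reduced_system _ _ _ sp pp s lambda (s ^+ 3) (s ^+ 3) x3 x1 s0 _ (lt0r_neq0 x3p).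
  + by ring.
  + by rewrite -c1; ring.
  + by rewrite -c3; ring.
  by apply: (root m) => //; move: mp; rewrite !inE => /orP[] ->; rewrite !orbT.
- move/(_ x2p): c2 => c2; move/(_ x3p): c3 => c3.
  have [|||m mp lm] := @reduced_system _ _ _ sq pq s lambda (s ^+ 4) (s ^+ 4) x3 x2 s0 _ (lt0r_neq0 x3p).
  + by ring.
  + by rewrite -c2; ring.
  + by rewrite -c3; ring.
  by apply: (root m) => //; move: mp; rewrite !inE => /orP[] ->; rewrite !orbT.
- move/(_ x1p): c1 => c1; move/(_ x2p): c2 => c2; move/(_ x3p): c3 => c3.
  have lx : lambda * (s * x1 - x2) = 0 by rewrite mulrBr mulrCA -c1 -c2; ring.
  have l0 : lambda != 0.
    (* The third row is the one without a negative entry, so it excludes [lambda = 0]. *)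
    apply: contra_eq_neq c3 => ->; rewrite mul0r gt_eqF //.
    by rewrite !addr_gt0 // mulr_gt0 // exprn_gt0.
  have x2E : x2 = s * x1.
    by apply/eqP; rewrite eq_sym -subr_eq0; move/eqP: lx; rewrite mulf_eq0 (negbTE l0).
  subst x2.
  have [|||m mp lm] := @reduced_system _ _ _ sr pr s lambda (s ^+ 3) (s ^+ 3 + s ^+ 5) x3 x1 s0 _ (lt0r_neq0 x3p).
  + by ring.
  + by rewrite -c1; ring.
  + by rewrite -c3; ring.
  by apply: (root m) => //; move: mp; rewrite !inE => /orP[] ->; rewrite !orbT.
Qed.

(** With [a] for [s ^+ 2]: a root differs from each of the three values of [t] because its quadratic
    does not vanish there, and roots for different [t] differ because a root determines [t]. *)
Lemma A252_uniq (a p1 p2 q1 q2 r1 r2 : R) : 5 < a ->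
  p1 + p2 = a + 1 -> p1 * p2 = 2 * a -> p1 != p2 ->
  q1 + q2 = a ^+ 2 + 1 -> q1 * q2 = 2 * a ^+ 2 -> q1 != q2 ->
  r1 + r2 = a + a ^+ 2 + 1 -> r1 * r2 = 2 * (a + a ^+ 2) -> r1 != r2 ->
  uniq [:: a; a ^+ 2; a + a ^+ 2; p1; p2; q1; q2; r1; r2].
Proof.
move=> a5 sp pp np sq pq nq sr pr nr.
have [rp1 rp2] := reduced_poly_root sp pp.
have [rq1 rq2] := reduced_poly_root sq pq.
have [rr1 rr2] := reduced_poly_root sr pr.
have a2 : 5 * a < a ^+ 2 by rewrite expr2 ltr_pM2r //; lra.
have a3 : 5 * a ^+ 2 < a ^+ 3 by rewrite [ltRHS]exprS ltr_pM2r //; lra.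
have d12 : a != a ^+ 2 by apply/eqP; lra.
have d13 : a != a + a ^+ 2 by apply/eqP; lra.
have d23 : a ^+ 2 != a + a ^+ 2 by apply/eqP; lra.
have a0 : 0 < a by lra.
(* In each of the nine evaluations below a factor [a] splits off, and [5 < a] fixes the sign of the
   cofactor [c]. *)
have N (t u c : R) : c != 0 -> reduced_poly t u = a * c -> reduced_poly t u != 0.
  by move=> c0 ->; rewrite mulf_neq0 // gt_eqF.
have dist_root (t u m : R) : reduced_poly t m = 0 -> reduced_poly t u != 0 -> u != m.
  by move=> h; apply: contraNneq => ->; rewrite h.
have dist_poly (t u m k : R) : reduced_poly t m = 0 -> reduced_poly u k = 0 -> t != u -> m != k.
  by move=> h h'; apply: contra_neq => mk; apply: (reduced_poly_root_inj h); rewrite mk.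
have n11 : reduced_poly a a != 0.
  by apply: (N _ _ 1); [exact: oner_neq0|rewrite /reduced_poly; ring].
have n12 : reduced_poly a (a ^+ 2) != 0.
  apply: (N _ _ (a ^+ 3 - a ^+ 2 - a + 2)); last by rewrite /reduced_poly; ring.
  by rewrite gt_eqF //; lra.
have n13 : reduced_poly a (a + a ^+ 2) != 0.
  apply: (N _ _ (a ^+ 3 + a ^+ 2 - a + 1)); last by rewrite /reduced_poly; ring.
  by rewrite gt_eqF //; lra.
have n21 : reduced_poly (a ^+ 2) a != 0.
  apply: (N _ _ (- a ^+ 2 + 3 * a - 1)); last by rewrite /reduced_poly; ring.
  by rewrite lt_eqF //; lra.
have n22 : reduced_poly (a ^+ 2) (a ^+ 2) != 0.
  by apply: (N _ _ a); [rewrite gt_eqF|rewrite /reduced_poly; ring].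
have n23 : reduced_poly (a ^+ 2) (a + a ^+ 2) != 0.
  apply: (N _ _ (a ^+ 2 + 2 * a - 1)); last by rewrite /reduced_poly; ring.
  by rewrite gt_eqF //; lra.
have n31 : reduced_poly (a + a ^+ 2) a != 0.
  apply: (N _ _ (- a ^+ 2 + 2 * a + 1)); last by rewrite /reduced_poly; ring.
  by rewrite lt_eqF //; lra.
have n32 : reduced_poly (a + a ^+ 2) (a ^+ 2) != 0.
  apply: (N _ _ (- a ^+ 2 + a + 2)); last by rewrite /reduced_poly; ring.
  by rewrite lt_eqF //; lra.
have n33 : reduced_poly (a + a ^+ 2) (a + a ^+ 2) != 0.
  apply: (N _ _ (1 + a)); last by rewrite /reduced_poly; ring.
  by rewrite gt_eqF //; lra.
rewrite /= !inE !negb_or; do !(apply/andP; split) => //;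
  by [eapply dist_root; eassumption | eapply dist_poly; eassumption].
Qed.

End A252.

(** * Count and profile *)

Theorem proposition6p4 (R : realType) (s : R) (hs : 1 + Num.sqrt 2 < s) :
  ([set lambda | regular_pareto_eigenvalue (A252 s) lambda]%classic #= `I_9)%card /\
  exists tau : R -> {set 'I_3},
    assigned_support_map (A252 s) tau /\
    detailed_profile (A252 s) tau 1 1 0 1 2 2 2.
Proof.
have s_gt2 : 2 < s.
  have : 1 < Num.sqrt 2 :> R by rewrite -{1}sqrtr1 ltr_sqrt //; lra.
  by lra.
have s0 : 0 < s by lra.
have s2 : 2 < (s - 1) ^+ 2.
  have : Num.sqrt 2 ^+ 2 < (s - 1) ^+ 2.
    by rewrite ltr_pXn2r ?nnegrE ?sqrtr_ge0 //; lra.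
  by rewrite sqr_sqrtr //; lra.
have a5 : 5 < s ^+ 2 by nra.
have disc : 0 < (s ^+ 2) ^+ 2 - 6 * s ^+ 2 + 1.
  (* The hypothesis on [s] makes the first factor positive. *)
  have -> : (s ^+ 2) ^+ 2 - 6 * s ^+ 2 + 1 =
    ((s - 1) ^+ 2 - 2) * ((s + 1) ^+ 2 - 2) by ring.
  by rewrite mulr_gt0 ?subr_gt0 //; nra.
have s4 : s ^+ 4 = (s ^+ 2) ^+ 2 by rewrite -exprM.
have t2 : 5 * s ^+ 2 < s ^+ 4 by rewrite s4 [ltRHS]expr2 ltr_pM2r; lra.
(* The other two values of [t] are at least [s ^+ 4], which exceeds 25. *)
have disc_gt6 (t : R) : 6 < t -> 0 < t ^+ 2 - 6 * t + 1.
  move=> t6; have -> : t ^+ 2 - 6 * t + 1 = t * (t - 6) + 1 by ring.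
  by rewrite addr_gt0 // mulr_gt0; lra.
have disc2 : 0 < (s ^+ 4) ^+ 2 - 6 * s ^+ 4 + 1 by apply: disc_gt6; lra.
have disc3 : 0 < (s ^+ 2 + s ^+ 4) ^+ 2 - 6 * (s ^+ 2 + s ^+ 4) + 1.
  by apply: disc_gt6; lra.
have [|p1 [p2 [sp pp p1p p2p np]]] := reduced_roots _ disc; first by lra.
have [|q1 [q2 [sq pq q1p q2p nq]]] := reduced_roots _ disc2; first by lra.
have [|r1 [r2 [sr pr r1p r2p nr]]] := reduced_roots _ disc3; first by lra.
pose vals := [seq s ^+ 2 * m | m <- [:: s ^+ 2; s ^+ 4; s ^+ 2 + s ^+ 4;
                                      p1; p2; q1; q2; r1; r2]].
pose supps : seq {set 'I_3} :=
  [:: [set idx1]; [set idx2]; [set idx1; idx2];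
      [set idx1; idx3]; [set idx1; idx3]; [set idx2; idx3]; [set idx2; idx3];
      finset.setT; finset.setT].
have uv : uniq vals.
  rewrite map_inj_uniq; last by apply: mulfI; rewrite expf_neq0 // gt_eqF.
  by move: sq pq sr pr; rewrite s4 => *; apply: A252_uniq.
(* Off the list the index is 9, and the default [finset.set0] is returned. *)
pose tau y := nth finset.set0 supps (index y vals).
have regular i : (i < 9)%N -> pareto_eigenvalue (A252 s) (nth 0 vals i) /\
    regularly_produced (A252 s) (nth finset.set0 supps i) (nth 0 vals i).
  have mem1 (x y : R) : x \in [:: x; y] by rewrite mem_head.
  have mem2 (x y : R) : y \in [:: x; y] by rewrite !inE eqxx orbT.
  case: i => [_|[_|[_|[_|[_|[_|[_|[_|[_|//]]]]]]]]] /=.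
  - exact: A252_support1.
  - exact: A252_support2.
  - exact: A252_support12.
  - exact: (A252_support13 sp pp).
  - exact: (A252_support13 sp pp).
  - exact: (A252_support23 sq pq).
  - exact: (A252_support23 sq pq).
  - exact: (A252_support123 sr pr).
  - exact: (A252_support123 sr pr).
have all_regular y : y \in vals ->
    pareto_eigenvalue (A252 s) y /\ regularly_produced (A252 s) (tau y) y.
  by move=> yv; have := regular _ (etrans (index_mem y vals) yv); rewrite nth_index.
have spec y : pareto_eigenvalue (A252 s) y -> y \in vals by exact: A252_spectrum.
have specE : pareto_spectrum (A252 s) = [set` vals]%classic.
  by apply/seteqP; split=> y /=; [exact: spec|move/all_regular => []].
split.
  have -> : [set lambda | regular_pareto_eigenvalue (A252 s) lambda]%classic = [set` vals]%classic.
    apply/seteqP; split=> y /=; first by move=> [/spec].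
    by move=> /all_regular[yp yr]; split=> //; exists (tau y).
  exact: (card_set_uniq_seq uv).
exists tau; split.
  move=> y /spec /all_regular[_ [Jn0 _ [u pu _]]]; split=> //; by exists u.
(* Membership triples turn equality of supports into a Boolean computation, so that the counts
   evaluate. *)
pose code (J : {set 'I_3}) := (idx1 \in J, idx2 \in J, idx3 \in J).
have codeI : injective code.
  by move=> J K [h1 h2 h3]; apply/setP; apply: ord3P.
have count_code J k : count_mem (code J) (map code supps) = k ->
    support_count (A252 s) tau J k.
  rewrite count_map (eq_count (a2 := pred1 J)) => [<-|K /=].
    exact: support_count_index.
  by rewrite (inj_eq codeI).
by split; [split..|]; apply: count_code; rewrite /code /= !inE.
Qed.
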